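(* For every integer $s\ge 2$, the number of pairwise non-isomorphic graphs that are isomorphic to $\mathcal{G}(w)$ for some slender word $w$ over $\Sigma_s$ equals the number of partitions of the integer $s$.
   Context: For $s\ge 2$, $\Sigma_s$ denotes the ordered alphabet $\{a_1<a_2<\dots<a_s\}$. A word $w$ over $\Sigma_s$ is slender if $|w|_{a}=1$ for every $a\in\Sigma_s$, i.e. each letter of $\Sigma_s$ occurs exactly once in $w$. For a nonempty word $w=w_1\cdots w_n$ over $\Sigma_s$, the Parikh graph $\mathcal{G}(w)$ is the simple undirected graph with vertex set $\{1,\dots,n\}$ in which, for $1\le i<j\le n$, vertices $i$ and $j$ are adjacent if and only if $w_i=a_k$ and $w_j=a_{k+1}$ for some $1\le k\le s-1$. A partition of $s$ is an unordered multiset of positive integers summing to $s$. *)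

(* Defs.v *)
From mathcomp Require Import all_boot.

Set Implicit Arguments.
Unset Strict Implicit.
Unset Printing Implicit Defensive.

(* Finite simple undirected graphs. *)
Record sgraph := SGraph {
  vertex :> finType;
  adj : rel vertex;
  adj_sym : symmetric adj;
  adj_irrefl : irreflexive adj }.

Definition isomorphic (G H : sgraph) : Prop :=
  exists2 f : G -> H, bijective f & forall x y, adj (f x) (f y) = adj x y.

(* For an isomorphism-invariant P, the graphs satisfying P form exactly N
   isomorphism classes: R lists one representative of each class. *)
Definition num_iso_classes (P : sgraph -> Prop) (N : nat) : Prop :=
  exists R : 'I_N -> sgraph,
    (forall i j, i != j -> ~ isomorphic (R i) (R j)) /\
    (forall G, P G <-> exists i, isomorphic G (R i)).

(* The letter a_k of the ordered alphabet {a_1 < ... < a_s} is the element of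
   'I_s of value k - 1; likewise the positions 1, ..., n of a word of length n
   are numbered from 0. *)
Definition word (s : nat) := seq 'I_s.

Definition slender s (w : word s) : Prop := forall a : 'I_s, count_mem a w = 1.

Section ParikhGraph.
Variables (s : nat) (w : word s).

Definition letter (i : 'I_(size w)) : 'I_s := tnth (in_tuple w) i.

Definition parikh_arc : rel 'I_(size w) :=
  fun i j => (i < j) && (letter j == (letter i).+1 :> nat).

Definition parikh_adj : rel 'I_(size w) :=
  fun i j => parikh_arc i j || parikh_arc j i.

Lemma parikh_adj_sym : symmetric parikh_adj.
Proof. by move=> i j; rewrite /parikh_adj orbC. Qed.

Lemma parikh_adj_irrefl : irreflexive parikh_adj.
Proof. by move=> i; rewrite /parikh_adj /parikh_arc ltnn. Qed.

Definition parikh_graph : sgraph := SGraph parikh_adj_sym parikh_adj_irrefl.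

End ParikhGraph.

(* A partition of n, as a multiset of positive integers with sum n, is given by
   its multiplicities: m i is the number of parts equal to i.+1. Parts and
   multiplicities of a partition of n never exceed n, so the bounds built in
   the type of m exclude no partition. *)
Definition partitions (n : nat) : {set {ffun 'I_n -> 'I_n.+1}} :=
  [set m : {ffun 'I_n -> 'I_n.+1} | \sum_(i < n) m i * i.+1 == n].

(* Main.v *)
(* In a slender word each letter has one position, so on letters the Parikh
   graph joins a_k to a_(k+1) exactly when a_k comes first: it is a disjoint union of
   paths. Conversely, inserting the letters in increasing order, each at
   the end or at the front of the word, realizes every choice of the joined
   pairs. Such a graph is determined up to isomorphism by the multiset of
   orders of its paths, which the numbers of vertices in components of each
   size recover. *)
Require Import Defs.
From mathcomp Require Import all_boot.

Set Implicit Arguments.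
Unset Strict Implicit.
Unset Printing Implicit Defensive.

(** * Graph isomorphism and disjoint unions *)

Lemma isomorphic_refl G : isomorphic G G.
Proof. by exists id => //; exists id. Qed.

Lemma isomorphic_sym G H : isomorphic G H -> isomorphic H G.
Proof.
case=> f [g fK gK] fadj; exists g; first by exists f.
by move=> x y; rewrite -fadj !gK.
Qed.

Lemma isomorphic_trans G H K :
  isomorphic G H -> isomorphic H K -> isomorphic G K.
Proof.
case=> f fbij fadj [g gbij gadj].
exists (g \o f); first exact: bij_comp.
by move=> x y; rewrite /= gadj fadj.
Qed.

Section DisjointUnion.
Variables G H : sgraph.

Definition sum_adj : rel (G + H) := fun u v =>
  match u, v with
  | inl x, inl y => adj x y
  | inr x, inr y => adj x y
  | _, _ => false
  end.

Lemma sum_adj_sym : symmetric sum_adj.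
Proof. by move=> [x|x] [y|y] //=; apply: adj_sym. Qed.

Lemma sum_adj_irrefl : irreflexive sum_adj.
Proof. by move=> [x|x] /=; apply: adj_irrefl. Qed.

Definition sum_graph : sgraph := SGraph sum_adj_sym sum_adj_irrefl.

End DisjointUnion.

Lemma sum_graph_iso G G' H H' :
  isomorphic G G' -> isomorphic H H' ->
  isomorphic (sum_graph G H) (sum_graph G' H').
Proof.
case=> f [f' fK f'K] fadj [g [g' gK g'K] gadj].
exists (fun u : G + H => match u with inl x => inl (f x) | inr x => inr (g x) end).
  exists (fun u : G' + H' =>
    match u with inl x => inl (f' x) | inr x => inr (g' x) end).
  - by move=> [x|x]; rewrite ?fK ?gK.
  - by move=> [x|x]; rewrite ?f'K ?g'K.
by move=> [x|x] [y|y] /=.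
Qed.

Definition sum_swap (A B : Type) (u : A + B) : B + A :=
  match u with inl x => inr x | inr x => inl x end.

Lemma sum_swapK A B : cancel (@sum_swap A B) (@sum_swap B A).
Proof. by case. Qed.

Lemma sum_swap_adj G H (u v : sum_graph G H) :
  @adj (sum_graph H G) (sum_swap u) (sum_swap v) = adj u v.
Proof. by case: u v => [x|x] [y|y]. Qed.

Lemma sum_graphC G H : isomorphic (sum_graph G H) (sum_graph H G).
Proof.
exists (@sum_swap G H); last exact: sum_swap_adj.
by exists (@sum_swap H G); apply: sum_swapK.
Qed.

Lemma sum_graphA G H K :
  isomorphic (sum_graph G (sum_graph H K)) (sum_graph (sum_graph G H) K).
Proof.
exists (fun u : G + (H + K) => match u with
  | inl x => inl (inl x) | inr (inl x) => inl (inr x) | inr (inr x) => inr x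
  end).
  exists (fun u : (G + H) + K => match u with
    | inl (inl x) => inl x | inl (inr x) => inr (inl x) | inr x => inr (inr x)
    end).
  - by move=> [x|[x|x]].
  - by move=> [[x|x]|x].
by move=> [x|[x|x]] [y|[y|y]].
Qed.

(** * Graphs joining only consecutive integers *)

Section LinearGraph.
Variables (n : nat) (b : pred nat).

(** [b i] decides whether [i] and [i.+1] are joined. Only its values at [i] with [i.+1 < n] matter;
    taking it on all of [nat] makes shifting and gluing easy. *)
Definition linear_adj : rel 'I_n := fun i j =>
  ((j == i.+1 :> nat) && b i) || ((i == j.+1 :> nat) && b j).

Lemma linear_adj_sym : symmetric linear_adj.
Proof. by move=> i j; rewrite /linear_adj orbC. Qed.

Lemma linear_adj_irrefl : irreflexive linear_adj.
Proof. by move=> i; rewrite /linear_adj -[i.+1]add1n eqn_leq /= ltnn andbF. Qed.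

Definition linear_graph : sgraph := SGraph linear_adj_sym linear_adj_irrefl.

End LinearGraph.

Definition path_graph n := linear_graph n predT.

Lemma eq_linear_graph n (b b' : pred nat) :
  (forall k, k.+1 < n -> b k = b' k) ->
  isomorphic (linear_graph n b) (linear_graph n b').
Proof.
move=> bb'; exists id; first by exists id.
move=> i j; rewrite /= /linear_adj.
by congr (_ || _); apply: andb_id2l => /eqP e; rewrite bb' // -e.
Qed.

(** The hypothesis cuts the edge between [k - 1] and [k]; in the form [i.+1 = k] it is vacuous for
    [k = 0]. *)
Lemma linear_graph_split k n (b : pred nat) :
  (forall i, i.+1 = k -> ~~ b i) ->
  isomorphic (sum_graph (linear_graph k b) (linear_graph n (fun i => b (k + i))))
             (linear_graph (k + n) b).
Proof.
move=> bk; exists (@unsplit k n).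
  by exists split; [apply: unsplitK | apply: splitK].
(* The only consecutive pair astride the cut is [k - 1], [k]. *)
have cross (i : 'I_k) (j : 'I_n) :
    linear_adj b (lshift n i) (rshift k j) = false.
  rewrite /linear_adj /=; apply/negbTE; rewrite negb_or.
  have ltik := ltn_ord i.
  apply/andP; split; last first.
    by rewrite negb_and (ltn_eqF (leq_trans ltik _)) // -addnS leq_addr.
  rewrite negb_and; case: eqP => //= e; apply: bk.
  by apply/eqP; rewrite eqn_leq ltik -e leq_addr.
move=> [x|x] [y|y]; rewrite [unsplit _]/= [unsplit _]/= //=.
- by rewrite linear_adj_sym cross.
- by rewrite /linear_adj /= -!addnS !eqn_add2l.
Qed.

(** * Disjoint unions of paths *)

Definition path_forest (c : seq nat) : sgraph :=
  foldr (fun n => sum_graph (path_graph n)) (path_graph 0) c.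

(** By induction on [c], its head is located in [c'] and brought to the front, using commutativity
    and associativity of disjoint union. *)
Lemma path_forest_perm c c' :
  perm_eq c c' -> isomorphic (path_forest c) (path_forest c').
Proof.
have swap1 x s1 s2 :
    isomorphic (path_forest (s1 ++ x :: s2)) (path_forest (x :: s1 ++ s2)).
  elim: s1 => [|y s1 IH] /=; first exact: isomorphic_refl.
  apply: isomorphic_trans (sum_graph_iso (isomorphic_refl _) IH) _ => /=.
  apply: isomorphic_trans (sum_graphA _ _ _) _.
  apply: isomorphic_trans (isomorphic_sym (sum_graphA _ _ _)).
  exact: sum_graph_iso (sum_graphC _ _) (isomorphic_refl _).
elim: c c' => [|x c IH] c' pcc'.
  by rewrite perm_sym in pcc'; rewrite (perm_nilP pcc'); apply: isomorphic_refl.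
have xc' : x \in c' by rewrite -(perm_mem pcc') mem_head.
case/splitPr: xc' pcc' => s1 s2.
rewrite perm_sym perm_catC /= perm_cons perm_catC perm_sym => /IH iso.
apply: isomorphic_trans (isomorphic_sym (swap1 _ _ _)).
exact: sum_graph_iso (isomorphic_refl _) iso.
Qed.

Lemma path_forest_linear c :
  exists b, isomorphic (path_forest c) (linear_graph (sumn c) b).
Proof.
elim: c => [|k c [b IH]]; first by exists predT; apply: isomorphic_refl.
(* The first [k] vertices form a path, no edge leaves [k - 1] upwards, and [b] shifted by [k]
   governs the rest. *)
pose b' i := if i < k then i.+1 < k else b (i - k).
exists b'; apply: isomorphic_trans (linear_graph_split _ _); last first.
  by move=> i ik; rewrite /b' -ik ltnSn ltnn.
apply: sum_graph_iso.
  by apply: eq_linear_graph => i lik; rewrite /b' (ltnW lik) lik.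
apply: isomorphic_trans IH _; apply: eq_linear_graph => i _.
by rewrite /b' ltnNge leq_addr addKn.
Qed.

(** The first path stops at the least [k] not joined to its successor; strong induction handles the
    vertices after it. *)
Lemma linear_path_forest n b : exists c,
  [/\ 0 \notin c, sumn c = n & isomorphic (linear_graph n b) (path_forest c)].
Proof.
have [m le_nm] := ubnP n; elim: m => // m IH in n b le_nm *.
case: n le_nm => [|n] lt_nm.
  by exists [::]; split=> //; apply: eq_linear_graph.
(* The last vertex is [n], and it ends a path whatever [b n] is. *)
have ex_end : exists k, (n <= k) || ~~ b k by exists n; rewrite leqnn.
case: (ex_minnP ex_end) => k kend kmin.
have le_kn : k <= n by apply: kmin; rewrite leqnn.
have [|c [c0 sc iso]] := IH (n - k) (fun i => b (k.+1 + i)).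
  by apply: leq_ltn_trans (leq_subr _ _) _; rewrite -ltnS.
exists (k.+1 :: c); split=> //=; first by rewrite sc addSn subnKC.
(* Splitting after [k] needs the predicate to fail at [k]. When [k = n], [b n] may hold, so [b] is
   first truncated, which leaves the graph unchanged. *)
pose b' i := b i && (i < n).
apply: (@isomorphic_trans _ (linear_graph n.+1 b')).
  by apply: eq_linear_graph => i; rewrite ltnS /b' => ->; rewrite andbT.
have -> : n.+1 = k.+1 + (n - k) by rewrite addSn subnKC.
apply: isomorphic_trans (isomorphic_sym (linear_graph_split _ _)) _.
  by move=> i [->]; rewrite /b' negb_and -leqNgt orbC.
apply: sum_graph_iso.
  apply: eq_linear_graph => i; rewrite ltnS => lt_ik.
  apply/negPn/negP; rewrite /b' negb_and -leqNgt orbC => /kmin.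
  by rewrite leqNgt lt_ik.
apply: isomorphic_trans iso; apply: eq_linear_graph => i lt_i.
by rewrite /b' [in X in _ && X]addSnnS -ltn_subRL lt_i andbT.
Qed.

(** * Component sizes as isomorphism invariants *)

Section Components.
Variable G : sgraph.

Definition comp_size (x : G) := #|connect (@adj G) x|.

(** This counts vertices, so it is [k] times the number of components of order [k]; the set of
    components need not be formed. *)
Definition comp_count k := #|[pred x : G | comp_size x == k]|.

End Components.

Lemma homo_connect (T T' : finType) (e : rel T) (e' : rel T') (f : T -> T') :
  {homo f : x y / e x y >-> e' x y} ->
  {homo f : x y / connect e x y >-> connect e' x y}.
Proof.
move=> fe x y /connectP[p ep ->]; apply/connectP; exists (map f p).
  exact: homo_path ep.
by rewrite last_map.
Qed.

Lemma comp_size_iso (G H : sgraph) (f : G -> H) :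
  bijective f -> (forall x y, adj (f x) (f y) = adj x y) ->
  forall x, comp_size (f x) = comp_size x.
Proof.
move=> [g fK gK] fadj x; rewrite /comp_size -(card_image (can_inj fK)).
apply: eq_card => y; apply/idP/imageP => [fxy | [z xz ->]].
  exists (g y); rewrite ?gK //; move: fxy; rewrite !inE -{2}(fK x).
  by apply: homo_connect => u v; rewrite -fadj !gK.
by move: xz; apply: homo_connect => u v; rewrite fadj.
Qed.

Lemma comp_count_iso G H : isomorphic G H -> comp_count G =1 comp_count H.
Proof.
case=> f fbij fadj k; have fI := bij_inj fbij; case: (fbij) => g fK gK.
rewrite /comp_count -(card_image fI); apply: eq_card => y.
apply/imageP/idP => [[x xk ->] | yk]; first by rewrite inE comp_size_iso.
by exists (g y); rewrite ?gK // inE -(comp_size_iso fbij fadj) gK.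
Qed.

(** A walk starting in the left summand never leaves it. *)
Lemma comp_size_inl G H x : comp_size (inl x : sum_graph G H) = comp_size x.
Proof.
have inl_inj : injective (@inl G H) by move=> u v [].
rewrite /comp_size -(card_image inl_inj).
apply: eq_card => u; apply/idP/imageP => [/connectP[p] | [y xy ->]]; last first.
  by move: xy; apply: homo_connect.
elim: p x => [|[z|z] p IH] x //=; first by move=> _ ->; exists x; rewrite ?inE.
case/andP=> xz zp up; have [y zy ->] := IH z zp up; exists y => //.
exact: connect_trans (connect1 xz) zy.
Qed.

Lemma comp_size_inr G H x : comp_size (inr x : sum_graph G H) = comp_size x.
Proof.
rewrite -(comp_size_inl G x) -(comp_size_iso _ (@sum_swap_adj G H)) //.
by exists (@sum_swap H G); apply: sum_swapK.
Qed.

Lemma comp_count_sum G H k :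
  comp_count (sum_graph G H) k = comp_count G k + comp_count H k.
Proof.
rewrite /comp_count -!sum1_card big_sumType /=.
by congr (_ + _); apply: eq_bigl => x; rewrite !inE ?comp_size_inl ?comp_size_inr.
Qed.

(** A path is connected: the larger of two vertices is reached from the smaller by unit steps, and
    adjacency is symmetric. *)
Lemma comp_size_path n (x : path_graph n) : comp_size x = n.
Proof.
have up d (i j : 'I_n) : j = i + d :> nat -> connect (@linear_adj n predT) i j.
  elim: d j => [|d IH] j ij.
    by rewrite (_ : j = i) //; apply: val_inj; rewrite /= ij addn0.
  have ltdn : i + d < n by apply: ltn_trans (ltn_ord j); rewrite ij addnS.
  apply: connect_trans (IH (Ordinal ltdn) (erefl _)) (connect1 _).
  by rewrite /linear_adj /= ij addnS eqxx.
rewrite /comp_size -[RHS]card_ord; apply: eq_card => y; rewrite !inE /=.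
have [le_xy | /ltnW le_yx] := leqP x y; first by apply: (up (y - x)); rewrite subnKC.
rewrite (sym_connect_sym (@linear_adj_sym n predT)).
by apply: (up (x - y)); rewrite subnKC.
Qed.


(** Each path of order [k] contributes its [k] vertices, so the multiplicity of any positive [k] can
    be read off the graph. *)
Lemma comp_count_path_forest c k :
  comp_count (path_forest c) k = k * count_mem k c.
Proof.
elim: c => [|n c IH] /=.
  by rewrite muln0; apply: eq_card0 => -[].
rewrite comp_count_sum IH mulnDr; congr (_ + _).
have [<- | neq_nk] := eqVneq n k; rewrite ?muln1 ?muln0.
  by rewrite -[RHS]card_ord; apply: eq_card => x; rewrite !inE comp_size_path eqxx.
by apply: eq_card0 => x; rewrite !inE comp_size_path (negbTE neq_nk).
Qed.

(** * Partitions as lists of parts *)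

Section Parts.
Variable s : nat.

Definition parts (m : {ffun 'I_s -> 'I_s.+1}) : seq nat :=
  flatten [seq nseq (m i) i.+1 | i : 'I_s].

Lemma sumn_parts m : sumn (parts m) = \sum_(i < s) m i * i.+1.
Proof.
rewrite sumn_flatten -map_comp sumnE big_map big_enum /=.
by apply: eq_bigr => i _; rewrite sumn_nseq mulnC.
Qed.

Lemma count_parts m (i : 'I_s) : count_mem i.+1 (parts m) = m i.
Proof.
rewrite count_flatten -map_comp sumnE big_map big_enum /= (bigD1 i) //=.
rewrite count_nseq /= eqxx mul1n big1 ?addn0 // => j neq_ji.
by rewrite count_nseq /= eqSS (inj_eq (@ord_inj _)) (negbTE neq_ji).
Qed.

Lemma parts_mem m k : k \in parts m -> 0 < k <= s.
Proof. by case/flatten_imageP=> i _; rewrite mem_nseq => /andP[_ /eqP->] /=. Qed.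

Lemma partsP c : 0 \notin c -> sumn c = s ->
  exists2 m, m \in partitions s & perm_eq c (parts m).
Proof.
move=> c0 sc.
have le_c k : k \in c -> k <= s.
  by move=> kc; rewrite -sc (perm_sumn (perm_to_rem kc)) leq_addr.
(* All parts being positive, there are at most [s] of them; hence multiplicities fit in ['I_s.+1]
   and [inord] below never takes its default value. *)
have le_size : size c <= s.
  rewrite -sc; elim: c c0 {sc le_c} => //= k c IH.
  by rewrite inE negb_or -add1n eq_sym -lt0n => /andP[k0 /IH]; apply: leq_add.
pose m : {ffun 'I_s -> 'I_s.+1} := [ffun i : 'I_s => inord (count_mem i.+1 c)].
have mE i : m i = count_mem i.+1 c :> nat.
  by rewrite ffunE inordK // ltnS (leq_trans (count_size _ _)).
have pcm : perm_eq c (parts m).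
  apply/allP => k _ /=; apply/eqP.
  (* Values outside [1, ..., s] occur in neither list. *)
  have [k_ok | k_out] := boolP (0 < k <= s).
    case: k k_ok => //= k lt_ks.
    by rewrite (count_parts m (Ordinal lt_ks)) mE.
  rewrite (count_memPn _) ?(count_memPn _) //.
    by apply: contra k_out => /parts_mem.
  apply: contra k_out => kc; rewrite le_c // andbT lt0n.
  by apply: contraNneq c0 => <-.
exists m => //; rewrite inE -sumn_parts -(perm_sumn pcm); exact/eqP.
Qed.

End Parts.

(** * Parikh graphs of slender words *)

(** Letters are plain naturals here, so that words over alphabets of different sizes can be compared
    in an induction. *)
Definition precedes (w : seq nat) k := index k w < index k.+1 w.

(** The isomorphism sends a position to its letter; it is bijective because each letter occurs
    exactly once. *)
Lemma parikh_graph_linear s (w : word s) : slender w ->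
  isomorphic (parikh_graph w) (linear_graph s (precedes (map val w))).
Proof.
move=> wP.
have w_all a : a \in w by rewrite -has_pred1 has_count wP.
have w_uniq : uniq w by apply: count_mem_uniq => a; rewrite wP w_all.
have w_size : size w = s.
  have /perm_size-> : perm_eq w (enum 'I_s).
    by apply: uniq_perm; rewrite ?enum_uniq // => a; rewrite w_all mem_enum.
  exact: size_enum_ord.
(* [index] inverts [letter], which turns comparison of positions into [precedes]. *)
have index_letter x : index (val (@letter s w x)) (map val w) = x.
  rewrite index_map; last exact: val_inj.
  by rewrite /letter (tnth_nth (tnth (in_tuple w) x)) index_uniq.
exists (@letter s w : parikh_graph w -> linear_graph s _).
  apply: inj_card_bij => /= [x y exy|]; last by rewrite !card_ord w_size.
  by apply: val_inj; rewrite /= -index_letter exy index_letter.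
move=> x y; rewrite /= /linear_adj /parikh_adj /parikh_arc /precedes.
by congr (_ || _); rewrite andbC; apply: andb_id2r => /eqP e;
   rewrite -e !index_letter.
Qed.

(* Placing k at the end or at the front of a word in 0, ..., k-1 makes k-1
   precede k or not, as prescribed by [b k.-1]; for k = 0 the choice is
   immaterial. *)
Fixpoint word_of (b : pred nat) n : seq nat :=
  if n is k.+1 then
    if b k.-1 then rcons (word_of b k) k else k :: word_of b k
  else [::].

Lemma perm_word_of b n : perm_eq (word_of b n) (iota 0 n).
Proof.
elim: n => //= n IH; rewrite -[0 :: _]/(iota 0 n.+1) -[n.+1]addn1 iotaD /= cats1.
rewrite perm_sym perm_rcons perm_sym.
by case: ifP => _; rewrite ?perm_rcons perm_cons.
Qed.

Lemma mem_word_of b n k : (k \in word_of b n) = (k < n).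
Proof. by rewrite (perm_mem (perm_word_of b n)) mem_iota. Qed.

(** The order of [k] and [k.+1] is settled when [k.+1] is inserted; later insertions at either end
    do not disturb it. *)
Lemma precedes_word_of b n k : k.+1 < n -> precedes (word_of b n) k = b k.
Proof.
rewrite /precedes; elim: n => //= n IH; rewrite ltnS leq_eqVlt.
case/orP=> [/eqP kn | lt_kn].
  rewrite -[in n.-1]kn /= kn; have lt_kn : k < n by rewrite -kn.
  case: ifP => _; last by rewrite /= eqxx.
  rewrite -cats1 !index_cat !mem_word_of lt_kn ltnn /= eqxx addn0.
  by rewrite index_mem mem_word_of.
case: ifP => _; last by rewrite /= !gtn_eqF ?(ltnW lt_kn) // ltnS IH.
by rewrite -cats1 !index_cat !mem_word_of lt_kn (ltnW lt_kn) IH.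
Qed.

Lemma linear_parikh_graph s b :
  exists2 w : word s, slender w & isomorphic (linear_graph s b) (parikh_graph w).
Proof.
(* All letters of [word_of b s] are below [s], so [pmap insub] discards none. *)
pose w : word s := pmap insub (word_of b s).
have wE : map val w = word_of b s.
  rewrite (pmap_filter (insubK _)); apply/all_filterP/allP => k.
  by rewrite mem_word_of isSome_insub.
have w_slender : slender w.
  move=> a; rewrite count_uniq_mem; last first.
    by rewrite -(map_inj_uniq val_inj) wE (perm_uniq (perm_word_of _ _)) iota_uniq.
  have : val a \in map val w by rewrite wE mem_word_of ltn_ord.
  by rewrite (mem_map val_inj) => ->.
exists w => //; apply: isomorphic_trans (isomorphic_sym (parikh_graph_linear w_slender)).
by apply: eq_linear_graph => k lt_ks; rewrite wE precedes_word_of.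
Qed.

Theorem theorem3p12 (s : nat) (hs : 2 <= s) :
  num_iso_classes
    (fun G : sgraph =>
       exists2 w : word s, slender w & isomorphic G (parikh_graph w))
    #|partitions s|.
Proof.
exists (fun j => path_forest (parts (enum_val j))); split.
  move=> i j /eqP neq_ij /comp_count_iso eq_count; apply: neq_ij.
  apply/enum_val_inj/ffunP => k; apply: val_inj => /=.
  (* The counted order [k.+1] is nonzero, so it cancels and leaves equal multiplicities. *)
  have := eq_count k.+1; rewrite !comp_count_path_forest !count_parts.
  by move/eqP; rewrite eqn_mul2l => /eqP.
move=> G; split=> [[w w_slender isoG] | [j isoG]].
  have [c [c0 sc isoc]] := linear_path_forest s (precedes (map val w)).
  have [m m_part pcm] := partsP c0 sc.
  exists (enum_rank_in m_part m); rewrite enum_rankK_in //.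
  apply: isomorphic_trans isoG _.
  apply: isomorphic_trans (parikh_graph_linear w_slender) _.
  exact: isomorphic_trans isoc (path_forest_perm pcm).
(* Conversely, the paths of a partition of [s] laid end to end form a linear graph on [s] vertices,
   which some slender word realizes. *)
have [b isob] := path_forest_linear (parts (enum_val j)).
have := enum_valP j; rewrite inE -sumn_parts => /eqP sum_s.
rewrite sum_s in isob; have [w w_slender isow] := linear_parikh_graph s b.
exists w => //; apply: isomorphic_trans isoG _.
exact: isomorphic_trans isob isow.
Qed.
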